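(* Suppose that $\mu_F>0$, and let $x^\star$ be the unique minimizer of $F(x)+R(x)+H(Kx)$ over $x\in\mathcal{X}$. Let $\kappa\in(0,1)$ and $\gamma_0\in(0,2(1-\kappa)/L_F)$. Set $\gamma_1=\gamma_0$ and $$\gamma_{k+1}=-\gamma_k^2\mu_F\kappa+\gamma_k\sqrt{(\gamma_k\mu_F\kappa)^2+1},\quad\text{for every }k\geq 1.$$ Suppose that $\eta\geq\|K\|^2$. Then in the PDDY algorithm with these stepsizes, there exists $c_0>0$ such that, for every $k\geq 1$, $$\|x^{k+1}-x^\star\|^2\leq\frac{\gamma_{k+1}^2}{1-\gamma_{k+1}\mu_F\kappa}\,c_0=O\big(1/k^2\big),$$ where the expression of the constant $c_0$ is $$c_0=\frac{1-\gamma_0\mu_F\kappa}{\gamma_0^2}\Big(\|x^1-x^\star\|^2+\gamma_0^2\eta\|u^1-u^0\|^2-\gamma_0^2\|K^*(u^1-u^0)\|^2\Big)+\eta\|u^1-u^\star\|^2,$$ with $u^\star$ any solution of the dual problem of minimizing $(F+R)^*(-K^*u)+H^*(u)$ over $u\in\mathcal{U}$; that is, $u^\star\in\partial H(Kx^\star)$ and $0\in\partial R(x^\star)+\nabla F(x^\star)+K^*u^\star$. Moreover, if $\eta>\|K\|^2$, then $\|x_R^k-x^\star\|^2=O(1/k^2)$ as well.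
   Context: $\mathcal{X}$ and $\mathcal{U}$ are finite-dimensional real Hilbert spaces, $K:\mathcal{X}\to\mathcal{U}$ is a linear operator with adjoint $K^*$ and operator norm $\|K\|$. $R:\mathcal{X}\to\mathbb{R}\cup\{+\infty\}$ and $H:\mathcal{U}\to\mathbb{R}\cup\{+\infty\}$ are proper, closed, convex functions, and $F:\mathcal{X}\to\mathbb{R}$ is convex and $L_F$-smooth (differentiable with $L_F$-Lipschitz gradient) for some $L_F>0$. $\mu_F\geq0$ denotes some constant such that $F$ is $\mu_F$-strongly convex, i.e. $F-\frac{\mu_F}{2}\|\cdot\|^2$ is convex. For a function $G$, $G^*$ is the convex conjugate and $\mathrm{prox}_G(z)=\arg\min_{z'}\{G(z')+\frac12\|z-z'\|^2\}$. Standing assumption: there exists $x^\star\in\mathcal{X}$ such that $0\in\nabla F(x^\star)+\partial R(x^\star)+K^*\partial H(Kx^\star)$. PDDY algorithm: given positive stepsizes $(\gamma_k)_{k\in\mathbb{N}}$, $\eta>0$ with $\eta\geq\|K\|^2$, $x_R^0\in\mathcal{X}$, $u^0\in\mathcal{U}$, set $p^0=K^*u^0$ and for $k=0,1,\ldots$ iterate $$u^{k+1}=\mathrm{prox}_{H^*/(\gamma_k\eta)}\big(u^k+\tfrac{1}{\gamma_k\eta}Kx_R^k\big),\qquad p^{k+1}=K^*u^{k+1},\qquad x^{k+1}=x_R^k-\gamma_k(p^{k+1}-p^k),$$ $$x_R^{k+1}=\mathrm{prox}_{\gamma_{k+1}R}\big(x^{k+1}-\gamma_{k+1}\nabla F(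x^{k+1})-\gamma_{k+1}p^{k+1}\big).$$
   Formalization: The explicit constant bound is false as written: 1−γμ_Fκ is replaced by 1−2γμ_Fκ in its prefactor and in c_0; the original prefactor is kept only with some unspecified c_0>0. The explicit c_0 is only claimed ≥0 (it is 0 when started at a solution), and X is assumed nonzero. *)

(* Defs.v *)
From HB Require Import structures.
From mathcomp Require Import all_boot all_order all_algebra.
From mathcomp Require Import all_classical all_reals all_analysis.
Import Order.TTheory GRing.Theory Num.Theory.
Import numFieldNormedType.Exports.

Set Implicit Arguments.
Unset Strict Implicit.
Unset Printing Implicit Defensive.

Local Open Scope classical_set_scope.
Local Open Scope ring_scope.

(* Finite-dimensional real Hilbert spaces: the norm (hence the topology) is the
   one of the inner product; `inner_norm` also makes `inner` positive definite,
   and completeness is automatic in finite dimension. *)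
HB.mixin Record isHilbert (R : realType) V
    of NormedModule R V & Vector R V := {
  inner : V -> V -> R;
  inner_linear : forall (a : R) (x y z : V),
    inner (a *: x + y) z = a * inner x z + inner y z;
  inner_sym : forall x y : V, inner x y = inner y x;
  inner_norm : forall x : V, `|x| ^+ 2 = inner x x }.

#[short(type="finHilbertType")]
HB.structure Definition FinHilbert (R : realType) :=
  {V of isHilbert R V & NormedModule R V & Vector R V}.

Section ConvexAnalysis.
Context {R : realType} {X : finHilbertType R}.
Implicit Types (f G : X -> \bar R) (F : X -> R) (x z : X).
Local Open Scope ereal_scope.

Definition proper_ereal f := (forall x, f x != -oo) /\ exists x, f x != +oo.

Definition convex_ereal f := forall (t : R) x y, (0 <= t <= 1)%R ->
  f (t *: x + (1 - t) *: y)%R <= t%:E * f x + (1 - t)%:E * f y.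

Definition proper_closed_convex f :=
  [/\ proper_ereal f, lower_semicontinuous f & convex_ereal f].

Definition conjugate f : X -> \bar R :=
  fun u => ereal_sup [set (inner u x)%:E - f x | x in [set: X]].

Definition subdiff f x : set X :=
  [set g | forall y, f x + (inner g (y - x)%R)%:E <= f y].

Definition minimizer f x := forall y, f x <= f y.

(* `is_prox G z p` is `p = prox_G z`: for proper closed convex G the minimizer
   exists and is unique. *)
Definition is_prox G z p :=
  minimizer (fun z' => G z' + (2^-1 * `|z - z'| ^+ 2)%:E) p.

Definition is_gradient F (gradF : X -> X) := forall x,
  differentiable F x /\ forall h, 'd F x h = inner (gradF x) h.

Definition convex_smooth (L : R) F (gradF : X -> X) :=
  [/\ convex_function [set: X] F, is_gradient F gradF &
      forall x y, (`|gradF x - gradF y| <= L * `|x - y|)%R].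

Definition strongly_convex (mu : R) F :=
  convex_function [set: X] (fun x => F x - mu / 2 * `|x| ^+ 2)%R.

End ConvexAnalysis.

Section PrimalDual.
Context {R : realType} {X U : finHilbertType R}.

Definition is_adjoint (K : X -> U) (Kadj : U -> X) :=
  forall x u, inner (K x) u = inner x (Kadj u).

Definition opnorm (K : X -> U) : R :=
  sup [set `|K x| | x in [set x : X | `|x| <= 1]].

Definition primal_obj (F : X -> R) (Rf : X -> \bar R) (H : U -> \bar R)
    (K : X -> U) : X -> \bar R :=
  fun x => ((F x)%:E + Rf x + H (K x))%E.

Definition dual_obj (F : X -> R) (Rf : X -> \bar R) (H : U -> \bar R)
    (Kadj : U -> X) : U -> \bar R :=
  fun u => (conjugate (fun x => (F x)%:E + Rf x) (- Kadj u)%R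
            + conjugate H u)%E.

(* u \in \partial H(K x) and 0 \in \partial Rf(x) + \nabla F(x) + K^* u; the
   existence of such a u is 0 \in \nabla F(x) + \partial Rf(x)
   + K^* \partial H(K x). *)
Definition kkt (gradF : X -> X) (Rf : X -> \bar R) (H : U -> \bar R)
    (K : X -> U) (Kadj : U -> X) (x : X) (u : U) :=
  subdiff H (K x) u /\
  exists2 r, subdiff Rf x r & r + gradF x + Kadj u = 0.

(* The iterate x 0 is not used: the primal sequence starts at x 1. *)
Record PDDY (gradF : X -> X) (Rf : X -> \bar R) (H : U -> \bar R)
    (K : X -> U) (Kadj : U -> X) (gamma : nat -> R) (eta : R)
    (xR x p : nat -> X) (u : nat -> U) : Prop := {
  pddy_p0 : p 0%N = Kadj (u 0%N);
  pddy_u : forall k,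
    is_prox (fun v => ((gamma k * eta)^-1%:E * conjugate H v)%E)
      (u k + (gamma k * eta)^-1 *: K (xR k)) (u k.+1);
  pddy_p : forall k, p k.+1 = Kadj (u k.+1);
  pddy_x : forall k, x k.+1 = xR k - gamma k *: (p k.+1 - p k);
  pddy_xR : forall k,
    is_prox (fun v => ((gamma k.+1)%:E * Rf v)%E)
      (x k.+1 - gamma k.+1 *: gradF (x k.+1) - gamma k.+1 *: p k.+1)
      (xR k.+1) }.

End PrimalDual.

(* Main.v *)
Require Import Defs.
From mathcomp Require Import all_boot all_order all_algebra.
From mathcomp Require Import all_classical all_reals all_analysis.
From mathcomp Require Import ring lra.
Import Order.TTheory GRing.Theory Num.Theory.
Import numFieldNormedType.Exports.

(** The proof is a Lyapunov argument.  Let [xs] be the primal solution, let [us]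
be a dual solution, and put [m = mu_F * kappa].

One iteration is a forward step on [F] followed by implicit steps on [Rf] and
on the conjugate of [H].  The optimality conditions of the two proximal
problems ([prox_subdiff]) say that the implicit steps use subgradients;
monotonicity of subdifferentials then gives, after expanding the squares
([primal_dual_step]), with [g] the current stepsize,

  |x' - xs|^2 + g^2 eta |u' - us|^2
    <= |x - xs|^2 - 2 g <dF, x - xs> + g^2 |dF|^2 + g^2 eta |u - us|^2
       - g^2 (eta |u' - u|^2 - |Kadj (u' - u)|^2),

where [dF = gradF x - gradF xs].  The last parenthesis is nonnegative, because
[|Kadj v|^2 <= opnorm K ^+ 2 * |v|^2 <= eta |v|^2].  Cocoercivity of the
gradient (Baillon and Haddad, [gradient_cocoercive]) absorbs [g^2 |dF|^2] into
part of the inner product, since [g L_F <= 2 (1 - kappa)]; strong monotonicity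
turns the rest into the contraction factor [1 - 2 g m] on [|x - xs|^2]
([forward_step]).

The stepsizes solve [g'^2 = g^2 (1 - 2 g' m)] ([step_recurrence]), which is
exactly what makes, after division by [g^2], the coefficient [1 / g^2] of
[|x' - xs|^2] equal to the coefficient [(1 - 2 g' m) / g'^2] that the next
iteration needs.  So the energy

  (1 - 2 g m) / g^2 * |x - xs|^2 + eta |u - us|^2

does not increase ([energy_nincr]), and its initial bound is the constant of
the theorem.  Finally [1 / g] grows by at least [m] at each iteration
([step_inv_incr]), so that [g = O(1/k)], and the energy bound yields the
[O(1/k^2)] rate for [x]; it also bounds [u], hence [xR], which differs from the
next [x] by [g Kadj (u' - u)].

The condition [2 g m < 1] at the first iteration comes from [mu_F <= L_F] and
[4 kappa (1 - kappa) <= 1].  The theorem also states that dual minimizers are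
exactly the multipliers of the optimality system; this is Fenchel duality,
where the given solution of the system rules out a duality gap
([kkt_dual_minimizer]). *)

Set Implicit Arguments.
Unset Strict Implicit.
Unset Printing Implicit Defensive.

Local Open Scope classical_set_scope.
Local Open Scope ring_scope.

(** * Inner products and linear operators *)
Section InnerProduct.
Context {R : realType} {V : finHilbertType R}.
Implicit Types (x y z : V) (a : R).

Lemma innerDl x y z : inner (x + y) z = inner x z + inner y z.
Proof. by rewrite -{1}[x]scale1r inner_linear mul1r. Qed.

Lemma inner0l z : inner 0 z = 0 :> R.
Proof. by apply: (addrI (inner 0 z)); rewrite -innerDl !addr0. Qed.

Lemma innerZl a x z : inner (a *: x) z = a * inner x z.
Proof. by rewrite -[a *: x]addr0 inner_linear inner0l addr0. Qed.

Lemma innerNl x z : inner (- x) z = - inner x z.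
Proof. by rewrite -scaleN1r innerZl mulN1r. Qed.

Lemma innerDr x y z : inner z (x + y) = inner z x + inner z y.
Proof. by rewrite !(inner_sym z) innerDl. Qed.

Lemma innerZr a x z : inner z (a *: x) = a * inner z x.
Proof. by rewrite !(inner_sym z) innerZl. Qed.

Lemma innerNr x z : inner z (- x) = - inner z x.
Proof. by rewrite !(inner_sym z) innerNl. Qed.

(** Turns an identity or inequality between inner products of linear
combinations into polynomial arithmetic on the pairwise products. *)
Definition innerE :=
  (innerDl, innerDr, innerNl, innerNr, innerZl, innerZr).

Lemma inner_ge0 x : 0 <= inner x x :> R.
Proof. by rewrite -inner_norm sqr_ge0. Qed.

Lemma inner_suml (I : Type) (s : seq I) (f : I -> V) z :
  inner (\sum_(i <- s) f i) z = \sum_(i <- s) inner (f i) z.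
Proof.
by apply: (big_morph (inner^~ z)) => [x y|]; rewrite ?innerDl ?inner0l.
Qed.

(** Expanding the square of [|y| x - |x| y] gives [2 |x| |y|] times the
claim. *)
Lemma cauchy_schwarz x y : inner x y <= `|x| * `|y|.
Proof.
have [->|x0] := eqVneq x 0; first by rewrite inner0l normr0 mul0r.
have [->|y0] := eqVneq y 0; first by rewrite inner_sym inner0l normr0 mulr0.
have nx : 0 < `|x| by rewrite normr_gt0.
have ny : 0 < `|y| by rewrite normr_gt0.
have := inner_ge0 (`|y| *: x - `|x| *: y).
rewrite !innerE (inner_sym y x) -!inner_norm => h.
by rewrite -(ler_pM2l (mulr_gt0 nx ny)); lra.
Qed.

Lemma cauchy_schwarz_abs x y : `|inner x y| <= `|x| * `|y|.
Proof.
rewrite ler_norml cauchy_schwarz andbT -[`|x|]normrN lerNl -innerNl.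
exact: cauchy_schwarz.
Qed.

(** A Gram-Schmidt process: the sum on the right is the orthogonal projection
on the span.  Orthonormality of [e] need not be carried along, since the map
[P] is symmetric and fixes the span, which already makes [v - P v] orthogonal
to it; normalizing that vector gives the next element. *)
Lemma span_projection (q : seq V) : exists e : seq V,
  {in e, forall b, b \in <<q>>%VS} /\
  {in <<q>>%VS, forall x, x = \sum_(b <- e) inner x b *: b}.
Proof.
elim: q => [|v q [e [es eP]]].
  by exists [::]; split=> // x; rewrite span_nil memv0 big_nil => /eqP.
pose P x := \sum_(b <- e) inner x b *: b.
have PD x y : P (x + y) = P x + P y.
  by rewrite -big_split; apply: eq_bigr => b _; rewrite innerDl scalerDl.
have PZ a x : P (a *: x) = a *: P x.
  by rewrite /P scaler_sumr; apply: eq_bigr => b _; rewrite innerZl scalerA.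
have Ps x : P x \in <<q>>%VS.
  by rewrite /P big_seq memv_suml // => b /es bs; rewrite memvZ.
have Psym x y : inner (P x) y = inner (P y) x.
  rewrite /P !inner_suml; apply: eq_bigr => b _.
  by rewrite !innerZl (inner_sym b y) (inner_sym b x) mulrC.
pose w := v - P v.
have ws z : z \in <<q>>%VS -> inner z w = 0.
  move=> zs; rewrite innerDr innerNr (inner_sym z (P v)) Psym [P z]/P -eP //.
  by rewrite subrr.
have Pw : P w = 0.
  by rewrite PD -scaleN1r PZ {2}/P -eP // scaleN1r subrr.
pose b0 := `|w|^-1 *: w.
have b0w : inner w b0 *: b0 = w.
  have [w0|w0] := eqVneq w 0; first by rewrite /b0 w0 !scaler0.
  have nw : `|w| != 0 by rewrite normr_eq0.
  rewrite innerZr -inner_norm scalerA -[RHS]scale1r.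
  by congr (_ *: _); field.
have sub x : x \in <<q>>%VS -> x \in <<v :: q>>%VS.
  by apply: subvP; rewrite span_cons addvSr.
have wvs : w \in <<v :: q>>%VS.
  apply: rpredB; last exact: sub.
  by apply: memv_span; rewrite mem_head.
exists (b0 :: e); split=> [b|x].
  by rewrite inE => /orP[/eqP ->|/es /sub //]; rewrite memvZ.
rewrite span_cons => /memv_addP[_ /vlineP[a ->] [z zs ->]].
have -> : a *: v + z = a *: w + (a *: P v + z).
  by rewrite addrA -scalerDr subrK.
have ys : a *: P v + z \in <<q>>%VS by rewrite rpredD // memvZ.
move: (a *: P v + z) ys => y ys.
rewrite big_cons -/(P _) PD PZ Pw scaler0 add0r [P y]/P -eP //.
by rewrite innerDl [inner y _]innerZr ws // mulr0 addr0 innerZl -scalerA b0w.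
Qed.

End InnerProduct.

Section OperatorNorm.
Context {R : realType} {X U : finHilbertType R}.
Variables (K : {linear X -> U}) (Kadj : {linear U -> X}).

(** Expand [x] by [span_projection]: each coordinate is an inner product, hence
bounded by a multiple of [|x|]. *)
Lemma linear_bounded : exists C : R, forall x, `|K x| <= C * `|x|.
Proof.
have [e [_ eP]] := span_projection (vbasis {:X}).
exists (\sum_(b <- e) `|b| * `|K b|) => x.
have -> : K x = \sum_(b <- e) inner x b *: K b.
  rewrite {1}[x]eP; last by rewrite (span_basis (vbasisP _)) memvf.
  rewrite (big_morph K (linearD K) (linear0 K)).
  by apply: eq_bigr => b _; rewrite linearZ.
rewrite mulr_suml.
apply: le_trans (ler_norm_sum _ _ _) _.
apply: ler_sum => b _; rewrite normrZ.
rewrite mulrAC; apply: ler_wpM2r => //.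
by rewrite [leRHS]mulrC; exact: cauchy_schwarz_abs.
Qed.

(** Boundedness of [K] makes the supremum in [opnorm] a true upper bound. *)
Lemma opnorm_ub x : `|x| <= 1 -> `|K x| <= opnorm K.
Proof.
move=> x1; have [C KC] := linear_bounded.
apply: ub_le_sup; last by exists x.
exists `|C| => _ /= [y y1 <-]; apply: (le_trans (KC y)).
apply: (@le_trans _ _ (`|C| * `|y|)); first by rewrite ler_wpM2r // ler_norm.
by rewrite ler_piMr.
Qed.

Lemma opnorm_ge0 : 0 <= opnorm K.
Proof. by apply: le_trans (opnorm_ub (x := 0) _); rewrite ?normr0. Qed.

Lemma opnorm_le x : `|K x| <= opnorm K * `|x|.
Proof.
have [->|x0] := eqVneq x 0; first by rewrite linear0 !normr0 mulr0.
have nx : 0 < `|x| by rewrite normr_gt0.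
rewrite -ler_pdivrMr // mulrC -[`|x|^-1]ger0_norm ?invr_ge0 // -normrZ -linearZ.
by apply: opnorm_ub; rewrite normrZ normfV normr_id mulVf // gt_eqF.
Qed.

Hypothesis adjK : is_adjoint K Kadj.

(** [|Kadj v|^2] is the inner product of [K (Kadj v)] and [v]. *)
Lemma adjoint_opnorm_le v : `|Kadj v| <= opnorm K * `|v|.
Proof.
have [->|w0] := eqVneq (Kadj v) 0.
  by rewrite normr0 mulr_ge0 // opnorm_ge0.
have nw : 0 < `|Kadj v| by rewrite normr_gt0.
rewrite -(ler_pM2l nw) -expr2 inner_norm -adjK mulrA [X in X * _]mulrC.
apply: (le_trans (cauchy_schwarz _ _)).
by rewrite ler_wpM2r // opnorm_le.
Qed.

End OperatorNorm.

(** * Smooth and strongly convex functions *)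

(** How first order conditions are extracted from inequalities along a segment,
where the remainder divided by the step [t] is linear in [t]. *)
Lemma ler_linear_limit {R : realType} (a b c : R) :
  (forall t, 0 < t <= 1 -> a <= b + t * c) -> a <= b.
Proof.
move=> h; rewrite leNgt; apply/negP => ba.
have c0 : 0 <= `|c| by [].
have cc : c <= `|c| by exact: ler_norm.
have den : 0 < a - b + `|c| + 1 by lra.
(* With this [t], [t * (a - b + |c| + 1) = a - b], so [t * |c| < a - b]. *)
pose t := (a - b) / (a - b + `|c| + 1).
have t0 : 0 < t by rewrite divr_gt0 // subr_gt0.
have tE : t * (a - b + `|c| + 1) = a - b by rewrite divfK // gt_eqF.
have t1 : t <= 1 by rewrite ler_pdivrMr // mul1r; lra.
have := h t; rewrite t0 t1 => /(_ isT) ht.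
have : t * c <= t * `|c| by rewrite ler_wpM2l // ltW.
nra.
Qed.

Section SmoothConvex.
Context {R : realType} {X : finHilbertType R}.
Variables (F : X -> R) (gradF : X -> X) (L mu : R).
Implicit Types (x y d : X) (t : R).

Lemma convex_function_line (f : X -> R) : convex_function [set: X] f ->
  forall t x d, 0 <= t <= 1 ->
    f (x + t *: d) <= f x + t * (f (x + d) - f x).
Proof.
move=> cf t x d t01.
have := cf (Itv01 (andP t01).1 (andP t01).2) (x + d) x; rewrite !in_setT.
move=> /(_ isT isT); rewrite /conv /= /conv /= /unstable.onem.
rewrite (_ : t *: (x + d) + (1 - t) *: x = x + t *: d); last first.
  by rewrite scalerDr scalerBl scale1r addrC addrA subrK.
by move=> h; apply: (le_trans h); rewrite /GRing.scale /=; lra.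
Qed.

Section Gradient.
Hypothesis gradP : is_gradient F gradF.

Lemma is_derive_line x d t :
  is_derive t 1 (fun s => F (x + s *: d)) (inner (gradF (x + t *: d)) d).
Proof.
have [dF dE] := gradP (x + t *: d).
have E : (fun h : R => h^-1 *:
      (((fun s : R => F (x + s *: d)) \o shift t) (h *: 1) - F (x + t *: d)))
    = (fun h : R => h^-1 *:
      ((F \o shift (x + t *: d)) (h *: d) - F (x + t *: d))).
  apply/funext => h /=; congr (_ *: (F _ - _)).
  by rewrite [_ *: 1]mulr1 scalerDl addrCA.
apply: DeriveDef; first by rewrite /derivable E; exact: diff_derivable.
by rewrite /derive E -dE -deriveE.
Qed.

Hypothesis cvxF : convex_function [set: X] F.

(** The difference quotient along the segment is at most [F y - F x] by
convexity, and it tends to the directional derivative. *)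
Lemma gradient_ineq x y : F x + inner (gradF x) (y - x) <= F y.
Proof.
have [dF dE] := gradP x.
rewrite -lerBrDl -dE -deriveE //.
have := @cvg_dnbhs_at_right _ _ _ _ _ (diff_derivable (v := y - x) dF).
move=> /cvgr_to_le; apply; near=> h.
have h0 : 0 < h by near: h; exact: nbhs_right_gt.
have h1 : h <= 1 by near: h; exact: nbhs_right_le.
rewrite /= [_ *: _]mulrC ler_pdivrMr // addrC mulrC.
have := convex_function_line cvxF x (y - x) (t := h).
rewrite (ltW h0) h1 => /(_ isT).
by rewrite (addrC x (y - x)) subrK (addrC _ x); lra.
Unshelve. all: by end_near. Qed.

Section Smooth.
Hypothesis L0 : 0 < L.
Hypothesis gradL : forall x y, `|gradF x - gradF y| <= L * `|x - y|.

(** Mean value theorem on [0, 1] for [F (x + t *: d)] minus the quadratic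
[t <gradF x, d> + t^2 L |d|^2 / 2]; by the Lipschitz bound its derivative is
nonpositive. *)
Lemma descent_lemma x d :
  F (x + d) <= F x + inner (gradF x) d + L / 2 * `|d| ^+ 2.
Proof.
pose g (t : R) := inner (gradF x) d + L / 2 * `|d| ^+ 2 * (2 * t).
pose q (t : R) := inner (gradF x) d *: t + (L / 2 * `|d| ^+ 2) *: t ^+ 2.
have dq t : is_derive t 1 q (g t).
  rewrite /q /g; apply: is_derive_eq.
  by rewrite /GRing.scale /=; ring.
have df t := is_deriveB (is_derive_line x d t) (dq t).
have [c c01 /=] := MVT (ltr01 : 0 < 1 :> R) (fun t _ => df t)
  (derivable_within_continuous (fun t _ => @ex_derive _ _ _ _ _ _ _ (df t))).
rewrite !fctE.
have -> : q 1 = inner (gradF x) d + L / 2 * `|d| ^+ 2.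
  by rewrite /q /GRing.scale /=; ring.
have -> : q 0 = 0 by rewrite /q /GRing.scale /=; ring.
rewrite scale1r scale0r !addr0 /g.
have c0 : 0 < c by move: c01; rewrite in_itv /= => /andP[].
have : inner (gradF (x + c *: d) - gradF x) d <= L * (c * `|d| ^+ 2).
  apply: (le_trans (cauchy_schwarz _ _)).
  apply: (le_trans (ler_wpM2r (normr_ge0 d) (gradL _ _))).
  by rewrite addrAC subrr add0r normrZ gtr0_norm // expr2 !mulrA.
by rewrite !innerE; lra.
Qed.

(** The function [F - <gradF x, .>] is minimal at [x]; compare its value there
with the one after a gradient step of length [1 / L] from [y]. *)
Lemma gradient_ineq_smooth x y :
  F x + inner (gradF x) (y - x) + (2 * L)^-1 * `|gradF y - gradF x| ^+ 2 <= F y.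
Proof.
pose d := - L^-1 *: (gradF y - gradF x).
have := descent_lemma y d.
have := gradient_ineq x (y + d).
have -> : `|d| ^+ 2 = L ^- 2 * `|gradF y - gradF x| ^+ 2.
  by rewrite normrZ exprMn normrN normfV (gtr0_norm L0) exprVn.
have -> : inner (gradF x) (y + d - x) =
    inner (gradF x) (y - x) + inner (gradF x) d by rewrite -innerDr addrAC.
have : inner (gradF y) d - inner (gradF x) d =
    - L^-1 * `|gradF y - gradF x| ^+ 2.
  by rewrite -innerNl -innerDl /d innerZr inner_norm.
move: (inner _ d) (inner _ d) (`|_| ^+ 2) => u v w uv h1 h2.
have E : (2 * L)^-1 * w = L^-1 * w - L / 2 * (L ^- 2 * w).
  by field; exact: lt0r_neq0.
by rewrite E; lra.
Qed.

(** The Baillon-Haddad inequality: add [gradient_ineq_smooth] to its copy with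
[x] and [y] exchanged. *)
Lemma gradient_cocoercive x y :
  `|gradF x - gradF y| ^+ 2 <= L * inner (gradF x - gradF y) (x - y).
Proof.
have := gradient_ineq_smooth x y; have := gradient_ineq_smooth y x.
rewrite (distrC (gradF y)).
have E : (2 * L)^-1 * `|gradF x - gradF y| ^+ 2 =
  L^-1 * `|gradF x - gradF y| ^+ 2 / 2 by field; exact: lt0r_neq0.
rewrite E -ler_pdivrMl // !innerE; lra.
Qed.

(** Strong convexity along the segment, with [F] bounded below by its tangent
at [x], gives the claim up to the error [t * mu / 2 * |y - x|^2]. *)
Lemma strong_convexity_ineq (strongF : strongly_convex mu F) x y :
  F x + inner (gradF x) (y - x) + mu / 2 * `|y - x| ^+ 2 <= F y.
Proof.
apply: (@ler_linear_limit _ _ _ (mu / 2 * `|y - x| ^+ 2)) => t /andP[t0 t1].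
have := convex_function_line strongF x (y - x) (t := t).
rewrite (ltW t0) t1 => /(_ isT); have := gradient_ineq x (x + t *: (y - x)).
rewrite [x + _ - x]addrAC [x + (y - x)]addrC subrK subrr add0r => h1 h2.
rewrite -(ler_pM2l t0); move: h1 h2.
have -> : y = x + (y - x) by rewrite addrC subrK.
rewrite [x + (y - x) - x]addrAC subrr add0r; move: (y - x) => d.
by rewrite !inner_norm !innerE (inner_sym d x); lra.
Qed.

Lemma strong_monotonicity (strongF : strongly_convex mu F) x y :
  mu * `|x - y| ^+ 2 <= inner (gradF x - gradF y) (x - y).
Proof.
have := strong_convexity_ineq strongF x y.
have := strong_convexity_ineq strongF y x.
by rewrite (distrC y x) !innerE; lra.
Qed.

(** Both constants bound [<gradF v - gradF 0, v> / |v|^2] for a nonzero [v]. *)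
Lemma strong_convexity_le_smoothness (strongF : strongly_convex mu F) :
  (0 < \dim {:X})%N -> mu <= L.
Proof.
move=> dimX; have [v v0] : exists v : X, v != 0.
  exists (vpick {:X}); rewrite vpick0; apply: contraTneq dimX => ->.
  by rewrite dimv0.
have nv : 0 < `|v| ^+ 2 by rewrite exprn_gt0 // normr_gt0.
have := strong_monotonicity strongF v 0; rewrite subr0.
move=> /le_trans/(_ (cauchy_schwarz _ _)) h.
rewrite -(ler_pM2r nv); apply: (le_trans h).
have := gradL v 0; rewrite subr0 => /(ler_wpM2r (normr_ge0 v)).
by rewrite -mulrA -expr2.
Qed.

End Smooth.
End Gradient.
End SmoothConvex.

(** * Subdifferentials, conjugates and proximal points *)
Section Subdifferential.
Context {R : realType} {X : finHilbertType R}.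
Implicit Types (f G : X -> \bar R) (x y z p u v w g : X) (t gamma : R).
Local Open Scope ereal_scope.

Lemma proper_fin_num f x : proper_ereal f -> f x != +oo -> f x \is a fin_num.
Proof. by move=> [fN _] fx; rewrite fin_numE fN fx. Qed.

Lemma subdiff_fin_num f x g :
  proper_ereal f -> subdiff f x g -> f x \is a fin_num.
Proof.
move=> pf fg; apply: proper_fin_num => //; have [fN [y fy]] := pf.
apply: contra_neq fy => fx; have := fg y.
by rewrite fx addye // leye_eq => /eqP.
Qed.

Lemma subdiff_fine f x y g : proper_ereal f -> subdiff f x g ->
  f y \is a fin_num -> (fine (f x) + inner g (y - x) <= fine (f y))%R.
Proof.
by move=> pf fg fy; rewrite -lee_fin EFinD !fineK ?(subdiff_fin_num pf fg).
Qed.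

Lemma subdiff_monotone f x y g h : proper_ereal f ->
  subdiff f x g -> subdiff f y h -> (0 <= inner (g - h) (x - y))%R.
Proof.
move=> pf fg fh; have := subdiff_fine pf fg (subdiff_fin_num pf fh).
by have := subdiff_fine pf fh (subdiff_fin_num pf fg); rewrite !innerE; lra.
Qed.

(** First order optimality for a convex function plus a smooth one, where [g] is
the gradient of [phi] at [p]: move from [p] towards [y], divide by the step, and
let it tend to 0. *)
Lemma minimizer_subdiff G (phi : X -> R) gamma p g :
  proper_ereal G -> convex_ereal G -> (0 < gamma)%R ->
  (forall d, exists C, forall t, (0 <= t <= 1 ->
     phi (p + t *: d) <= phi p + t * inner g d + t ^+ 2 * C)%R) ->
  minimizer (fun v => gamma%:E * G v + (phi v)%:E) p ->
  subdiff G p (- gamma^-1 *: g)%R.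
Proof.
move=> pG cG gamma0 phiP minp; have [GN [y0 Gy0]] := pG.
have fin v : G v != +oo -> exists r, G v = r%:E.
  by move=> /(proper_fin_num pG)/fineK <-; exists (fine (G v)).
have [a Ga] : exists a, G p = a%:E.
  apply: (fin p); apply/eqP => Gp; have [b Gb] := fin _ Gy0.
  have := minp y0; rewrite Gb.
  by rewrite Gp gt0_muley ?lte_fin // addye // -EFinM -EFinD leye_eq.
move=> y; have [->|/eqP/fin[b Gb]] := pselect (G y = +oo).
  exact: leey.
rewrite Ga Gb -EFinD lee_fin innerZl.
have [C phiC] := phiP (y - p)%R.
have : (0 <= gamma * (b - a) + inner g (y - p))%R.
  apply: (@ler_linear_limit _ _ _ C) => t /andP[t0 t1].
  have t01 : (0 <= t <= 1)%R by rewrite (ltW t0).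
  have := cG t y p t01.
  have -> : (t *: y + (1 - t) *: p = p + t *: (y - p))%R.
    by rewrite scalerBl scale1r scalerBr addrC addrAC addrA.
  rewrite Ga Gb -!EFinM -EFinD => cGt.
  have [c Gc] : exists c, G (p + t *: (y - p))%R = c%:E.
    by apply: (fin _); apply: contraTneq cGt => ->.
  move: cGt; rewrite Gc lee_fin => cGt.
  have := minp (p + t *: (y - p))%R.
  rewrite Ga Gc -!EFinM -!EFinD lee_fin => h.
  have h2 := phiC t t01.
  have h3 : (gamma * c <= gamma * (t * b + (1 - t) * a))%R.
    by rewrite ler_pM2l.
  by rewrite -(pmulr_rge0 _ t0); lra.
rewrite -(pmulr_rge0 _ (_ : 0 < gamma^-1)%R) ?invr_gt0 //.
by rewrite mulrDr mulKf ?gt_eqF //; lra.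
Qed.

(** For the quadratic [|z - .|^2 / 2] the upper bound asked by
[minimizer_subdiff] is an equality. *)
Lemma prox_subdiff G gamma z p :
  proper_ereal G -> convex_ereal G -> (0 < gamma)%R ->
  is_prox (fun v => gamma%:E * G v) z p ->
  subdiff G p (gamma^-1 *: (z - p))%R.
Proof.
move=> pG cG gamma0 minp.
have -> : (gamma^-1 *: (z - p) = - gamma^-1 *: (p - z))%R.
  by rewrite scaleNr -scalerN opprB.
apply: minimizer_subdiff minp => // d.
exists (2^-1 * `|d| ^+ 2)%R => t _.
by rewrite !inner_norm !innerE !(inner_sym d) (inner_sym p z); lra.
Qed.

Lemma subdiff_addl_gradient (F : X -> R) gradF x g f :
  (forall y, F x + inner (gradF x) (y - x) <= F y)%R ->
  subdiff f x g -> subdiff (fun y => (F y)%:E + f y) x (g + gradF x)%R.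
Proof.
move=> Fge fg y.
have -> : (F x)%:E + f x + (inner (g + gradF x) (y - x))%:E =
    (F x + inner (gradF x) (y - x))%:E + (f x + (inner g (y - x))%:E).
  by rewrite EFinD addeACA -EFinD innerDl (addrC (inner g _)).
by apply: leeD; rewrite ?lee_fin.
Qed.

(** The hard half of the sum rule: [x] minimizes [f + (F - <w, .>)], where the
second summand has gradient [gradF x - w]. *)
Lemma subdiff_addl_gradientN (F : X -> R) gradF (L : R) x w f :
  proper_ereal f -> convex_ereal f ->
  (forall d, F (x + d) <= F x + inner (gradF x) d + L / 2 * `|d| ^+ 2)%R ->
  subdiff (fun y => (F y)%:E + f y) x w -> subdiff f x (w - gradF x)%R.
Proof.
move=> pf cf Fle Ffw.
have -> : (w - gradF x = - 1^-1 *: (gradF x - w))%R.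
  by rewrite invr1 scaleN1r opprB.
apply: (@minimizer_subdiff f (fun y => F y - inner w y)%R) => //.
  move=> d; exists (L / 2 * `|d| ^+ 2)%R => t _.
  have := Fle (t *: d); rewrite normrZ exprMn real_normK ?num_real // !innerE.
  by lra.
move=> y; rewrite !mul1e; have := Ffw y.
have -> : f x + (F x - inner w x)%:E =
    (F x)%:E + f x + (inner w (y - x))%:E + (- inner w y)%:E.
  by case: (f x) => [a| |] //=; congr _%:E; rewrite !innerE; lra.
have -> : f y + (F y - inner w y)%:E = (F y)%:E + f y + (- inner w y)%:E.
  by rewrite EFinD addeA (addeC (f y)).
by move=> h; rewrite leeD2r.
Qed.

Lemma conjugate_ge f x u : (inner u x)%:E - f x <= conjugate f u.
Proof. by apply: ereal_sup_ubound; exists x. Qed.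

(** The equality case of the Fenchel-Young inequality [conjugate_ge]. *)
Lemma conjugate_subdiff f x u : proper_ereal f ->
  subdiff f x u -> conjugate f u = (inner u x)%:E - f x.
Proof.
move=> pf fu; apply/eqP; rewrite eq_le conjugate_ge andbT.
have /fineK fx := subdiff_fin_num pf fu.
apply: ge_ereal_sup => _ [y _ <-]; have := fu y; rewrite -fx.
case: (f y) => [b| |] //=; last by rewrite leNye.
by rewrite -?EFinN -?EFinD !lee_fin !innerE; lra.
Qed.

Lemma subdiff_of_conjugate f x u : f x \is a fin_num ->
  conjugate f u <= (inner u x)%:E - f x -> subdiff f x u.
Proof.
move=> /fineK fx cu y; have {cu} := le_trans (conjugate_ge f y u) cu.
rewrite -fx; case: (f y) => [b| |] //=; last by rewrite leey.
by rewrite -?EFinN -?EFinD !lee_fin !innerE; lra.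
Qed.

Lemma subdiff_conjugate f x u : proper_ereal f ->
  subdiff f x u -> subdiff (conjugate f) u x.
Proof.
move=> pf fu v; rewrite (conjugate_subdiff pf fu).
apply: le_trans (conjugate_ge f x v).
rewrite -(fineK (subdiff_fin_num pf fu)) -EFinN -!EFinD lee_fin.
by rewrite !innerE !(inner_sym x); lra.
Qed.

Lemma conjugate_gtNy f u : proper_ereal f -> conjugate f u != -oo.
Proof.
move=> pf; have [_ [y fy]] := pf; apply/eqP => cu.
have := conjugate_ge f y u.
by rewrite cu -(fineK (proper_fin_num pf fy)) -EFinN -EFinD leeNy_eq.
Qed.

Lemma conjugate_proper f x u : proper_ereal f ->
  subdiff f x u -> proper_ereal (conjugate f).
Proof.
move=> pf fu; split=> [v|]; first exact: conjugate_gtNy.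
exists u; rewrite (conjugate_subdiff pf fu).
by rewrite -(fineK (subdiff_fin_num pf fu)).
Qed.

(** A supremum of affine functions is convex. *)
Lemma conjugate_convex f : proper_ereal f -> convex_ereal (conjugate f).
Proof.
move=> pf t u v /andP[t0 t1]; apply: ge_ereal_sup => _ [x _ <-].
have [fx|/(proper_fin_num pf) fx] := eqVneq (f x) +oo.
  by rewrite fx /= leNye.
have -> : (inner (t *: u + (1 - t) *: v) x)%:E - f x =
    t%:E * ((inner u x)%:E - f x) + (1 - t)%:E * ((inner v x)%:E - f x).
  rewrite -(fineK fx) -?EFinN -?EFinD -?EFinM -?EFinD !innerE.
  by congr _%:E; ring.
by apply: leeD; apply: lee_wpmul2l; rewrite ?lee_fin ?subr_ge0 // conjugate_ge.
Qed.

End Subdifferential.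

(** * Primal and dual optimality *)
Section PrimalDual.
Context {R : realType} {X U : finHilbertType R}.
Variables (K : {linear X -> U}) (Kadj : {linear U -> X}).
Variables (Rf : X -> \bar R) (H : U -> \bar R) (F : X -> R) (gradF : X -> X).
Variables (L mu : R).
Hypothesis adjK : is_adjoint K Kadj.
Hypotheses (pR : proper_ereal Rf) (pH : proper_ereal H).
Hypothesis cR : convex_ereal Rf.
Local Open Scope ereal_scope.

(** Add the three lower bounds of [F], [Rf] and [H] at the optimal point; their
linear terms cancel by the optimality system. *)
Lemma kkt_primal_growth x u y :
  (forall y, F x + inner (gradF x) (y - x) + mu / 2 * `|y - x| ^+ 2 <= F y)%R ->
  kkt gradF Rf H K Kadj x u ->
  primal_obj F Rf H K x + (mu / 2 * `|y - x| ^+ 2)%:E <= primal_obj F Rf H K y.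
Proof.
move=> /(_ y) Fy [Hu [r Rr]] /(congr1 (fun z : X => inner z (y - x)%R)).
have := Rr y; have := Hu (K y); rewrite /primal_obj.
rewrite -(fineK (subdiff_fin_num pR Rr)) -(fineK (subdiff_fin_num pH Hu)).
rewrite -linearB (inner_sym u) adjK (inner_sym _ (Kadj u)).
rewrite !innerDl inner0l; case: (Rf y) (pR.1 y) => [a _| |] //; last first.
  by move=> _ _ _ _; case: (H (K y)) (pH.1 (K y)) => [b| |] //= _; rewrite leey.
case: (H (K y)) => [b| |] //=; last by move=> *; rewrite leey.
by rewrite -?EFinN -?EFinD !lee_fin; lra.
Qed.

Lemma kkt_unique_minimizer x u : (0 < mu)%R ->
  (forall y, F x + inner (gradF x) (y - x) + mu / 2 * `|y - x| ^+ 2 <= F y)%R ->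
  kkt gradF Rf H K Kadj x u -> unique (minimizer (primal_obj F Rf H K)) x.
Proof.
move=> mu0 Fge xu; have growth y := kkt_primal_growth y Fge xu.
split=> y.
  apply: le_trans (growth y); rewrite leeDl // lee_fin.
  by rewrite mulr_ge0 ?sqr_ge0 // divr_ge0 // ltW.
move=> /(_ x) /(le_trans (growth y)); have [Hu [r Rr _]] := xu.
rewrite /primal_obj.
rewrite -(fineK (subdiff_fin_num pR Rr)) -(fineK (subdiff_fin_num pH Hu)).
rewrite -!EFinD lee_fin gerDl pmulr_rle0 ?divr_gt0 // => h.
have : (`|y - x| ^+ 2 == 0)%R by rewrite eq_le h sqr_ge0.
by rewrite sqrf_eq0 normr_eq0 subr_eq0 => /eqP.
Qed.

(** The Fenchel-Young inequalities of [F + Rf] and of [H] at [x] add up to weak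
duality, and they are equalities exactly when the optimality system holds.
The solution [u] shows that the bound is attained, so a dual minimizer [v] must
turn both inequalities into equalities. *)
Lemma kkt_dual_minimizer x u v :
  (forall y, F x + inner (gradF x) (y - x) <= F y)%R ->
  (forall d, F (x + d) <= F x + inner (gradF x) d + L / 2 * `|d| ^+ 2)%R ->
  kkt gradF Rf H K Kadj x u ->
  minimizer (dual_obj F Rf H Kadj) v <-> kkt gradF Rf H K Kadj x v.
Proof.
move=> Fge Fle xu.
pose f y := (F y)%:E + Rf y.
have [Hu [r Rr _]] := xu.
have Rx := subdiff_fin_num pR Rr; have Hx := subdiff_fin_num pH Hu.
have pf : proper_ereal f.
  split=> [y|]; first by rewrite /f; case: (Rf y) (pR.1 y).
  by exists x; rewrite /f -(fineK Rx).
have fx : f x \is a fin_num by rewrite /f fin_numD Rx.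
pose bound_f w := (inner (- Kadj w) x)%:E - f x.
pose bound_H w := (inner w (K x))%:E - H (K x).
have boundE w : bound_f w + bound_H w = - f x - H (K x).
  rewrite /bound_f /bound_H -(fineK fx) -(fineK Hx) innerNl.
  rewrite (inner_sym w) adjK (inner_sym x).
  by rewrite -!EFinN -!EFinD; congr _%:E; lra.
have weak w : - f x - H (K x) <= dual_obj F Rf H Kadj w.
  by rewrite -(boundE w) leeD // conjugate_ge.
have kkt_value w : kkt gradF Rf H K Kadj x w ->
    dual_obj F Rf H Kadj w = - f x - H (K x).
  move=> [Hw [s Rs sE]]; rewrite -(boundE w) /dual_obj; congr (_ + _).
    apply: conjugate_subdiff => //.
    have -> : (- Kadj w = s + gradF x)%R.
      by apply/eqP; rewrite eq_sym -addr_eq0 sE.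
    exact: subdiff_addl_gradient.
  exact: conjugate_subdiff.
split=> [minv|/kkt_value vE w]; last by rewrite vE.
have := minv u; rewrite (kkt_value _ xu) -(boundE v) => Dv.
have bf : bound_f v <= conjugate f (- Kadj v)%R by exact: conjugate_ge.
have bH : bound_H v <= conjugate H v by exact: conjugate_ge.
have bffin : bound_f v \is a fin_num by rewrite fin_numB fx.
have bHfin : bound_H v \is a fin_num by rewrite fin_numB Hx.
(* The two summands of the dual value at [v] are at least [bound_f v] and
   [bound_H v], and their sum is at most the sum of these, so each is equal. *)
have fv : subdiff f x (- Kadj v)%R.
  apply: subdiff_of_conjugate => //; rewrite -/(bound_f v).
  rewrite -(leeD2rE _ _ bHfin); apply: le_trans Dv.
  by rewrite leeD2l.
have Hv : subdiff H (K x) v.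
  apply: subdiff_of_conjugate => //; rewrite -/(bound_H v).
  rewrite -(leeD2lE _ _ bffin); apply: le_trans Dv.
  by rewrite leeD2r.
split=> //; exists (- Kadj v - gradF x)%R; last by rewrite subrK addNr.
exact: subdiff_addl_gradientN Fle fv.
Qed.

End PrimalDual.

(** * The stepsizes *)
Section StepSizes.
Context {R : realType}.
Variables (m : R) (gamma : nat -> R).
Hypotheses (m0 : 0 < m) (gamma0 : 0 < gamma 0%N).
Hypothesis gamma0m : 2 * gamma 0%N * m < 1.
Hypothesis gamma1 : gamma 1%N = gamma 0%N.
Hypothesis gammaS : forall k, (1 <= k)%N ->
  gamma k.+1 = - gamma k ^+ 2 * m
    + gamma k * Num.sqrt ((gamma k * m) ^+ 2 + 1).

Lemma step_gt0 k : 0 < gamma k.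
Proof.
case: k => // k; elim: k => [|k IH]; first by rewrite gamma1.
rewrite gammaS //; set g := gamma k.+1 in IH *.
have gm0 : 0 < g * m by rewrite mulr_gt0.
have : g * m < Num.sqrt ((g * m) ^+ 2 + 1).
  rewrite -[ltLHS]gtr0_norm // -sqrtr_sqr ltr_sqrt ?ltrDl //.
  by rewrite ltr_wpDl // sqr_ge0.
by rewrite -(ltr_pM2l IH); lra.
Qed.

(** The stepsize rule picks the positive root of this quadratic equation. *)
Lemma step_recurrence k :
  gamma k.+2 ^+ 2 = gamma k.+1 ^+ 2 * (1 - 2 * gamma k.+2 * m).
Proof.
rewrite (gammaS (k := k.+1)) //; set g := gamma k.+1.
have : Num.sqrt ((g * m) ^+ 2 + 1) ^+ 2 = (g * m) ^+ 2 + 1.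
  by rewrite sqr_sqrtr // addr_ge0 // sqr_ge0.
move: (Num.sqrt _) => s sE.
have -> : (- g ^+ 2 * m + g * s) ^+ 2 =
    g ^+ 2 * (s ^+ 2 + (g * m) ^+ 2 - 2 * (g * m) * s) by ring.
by rewrite sE; ring.
Qed.

(** Completing the square, [step_recurrence] reads
[(1/g' - m)^2 = (1/g)^2 + m^2]. *)
Lemma step_inv_incr k : (gamma k.+1)^-1 + m <= (gamma k.+2)^-1.
Proof.
have g0 := step_gt0 k.+1; have h0 := step_gt0 k.+2.
have rec := step_recurrence k.
have hm : 2 * gamma k.+2 * m < 1.
  by rewrite -subr_gt0 -(pmulr_rgt0 _ (exprn_gt0 2 g0)) -rec exprn_gt0.
have hV : m < (gamma k.+2)^-1.
  rewrite -(ltr_pM2l h0) mulfV ?gt_eqF //.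
  by have : 0 < gamma k.+2 * m; [rewrite mulr_gt0|lra].
have sq : ((gamma k.+2)^-1 - m) ^+ 2 = (gamma k.+1)^-1 ^+ 2 + m ^+ 2.
  apply: (mulfI (_ : gamma k.+1 ^+ 2 * gamma k.+2 ^+ 2 != 0)).
    by rewrite mulf_neq0 // expf_neq0 // gt_eqF.
  have -> : gamma k.+1 ^+ 2 * gamma k.+2 ^+ 2 * ((gamma k.+2)^-1 - m) ^+ 2 =
      gamma k.+1 ^+ 2 * (1 - 2 * gamma k.+2 * m)
        + gamma k.+1 ^+ 2 * gamma k.+2 ^+ 2 * m ^+ 2.
    by field; rewrite gt_eqF.
  by rewrite -rec; field; rewrite gt_eqF.
rewrite -lerBrDr -(@ler_pXn2r _ 2) ?nnegrE //.
- by rewrite sq lerDl sqr_ge0.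
- by rewrite invr_ge0 ltW.
- by rewrite subr_ge0 ltW.
Qed.

Lemma step_inv_ge k : k.+1%:R * m <= (gamma k.+1)^-1.
Proof.
elim: k => [|k IH].
  rewrite mul1r gamma1 -(ler_pM2l gamma0) mulfV ?gt_eqF //.
  by have := mulr_gt0 gamma0 m0; move: gamma0m; lra.
apply: le_trans (step_inv_incr k).
by rewrite -natr1 mulrDl mul1r lerD2r.
Qed.

Lemma step_le_first k : gamma k.+1 <= gamma 0%N.
Proof.
elim: k => [|k IH]; first by rewrite gamma1.
apply: le_trans IH; rewrite -lef_pV2 ?posrE ?step_gt0 //.
by apply: le_trans (step_inv_incr k); rewrite lerDl ltW.
Qed.

Lemma step_lt1 k : 2 * gamma k.+1 * m < 1.
Proof.
by apply: le_lt_trans gamma0m; rewrite ler_pM2r // ler_pM2l // step_le_first.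
Qed.

(** The coefficient of the primal distance in the energy of one iteration is the
one produced by the previous iteration. *)
Lemma step_ratio k :
  gamma k.+2 ^+ 2 / (1 - 2 * gamma k.+2 * m) = gamma k.+1 ^+ 2.
Proof.
by rewrite step_recurrence mulfK // gt_eqF // subr_gt0 step_lt1.
Qed.

(** This comparison and the next one pass between the factors
[1 - 2 g m] and [1 - g m], at the price of a constant. *)
Lemma step_ratio_half_le k :
  gamma k.+1 ^+ 2 / (1 - gamma k.+1 * m)
    <= gamma k.+1 ^+ 2 / (1 - 2 * gamma k.+1 * m).
Proof.
have gm := mulr_gt0 (step_gt0 k.+1) m0; have dm := step_lt1 k.
rewrite ler_pM2l ?exprn_gt0 ?step_gt0 // lef_pV2 ?posrE; lra.
Qed.

Lemma step_ratio_le_half k :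
  gamma k.+1 ^+ 2 / (1 - 2 * gamma k.+1 * m)
    <= gamma k.+1 ^+ 2 / (1 - gamma k.+1 * m) / (1 - 2 * gamma 0%N * m).
Proof.
have gm := mulr_gt0 (step_gt0 k.+1) m0; have dm := step_lt1 k.
have d0 : 0 < 1 - 2 * gamma 0%N * m by rewrite subr_gt0.
have d1 : 0 < 1 - gamma k.+1 * m by lra.
have d2 : 0 < 1 - 2 * gamma k.+1 * m by rewrite subr_gt0.
rewrite -[leRHS]mulrA ler_pM2l ?exprn_gt0 ?step_gt0 //.
rewrite -invfM lef_pV2 ?posrE ?mulr_gt0 //.
have le_first : 1 - 2 * gamma 0%N * m <= 1 - 2 * gamma k.+1 * m.
  by rewrite lerD2l lerN2 ler_pM2r // ler_pM2l // step_le_first.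
by apply: le_trans le_first; rewrite ler_piMl ?(ltW d0) // lerBlDr lerDl ltW.
Qed.

Lemma step_sqr_le k : gamma k.+1 ^+ 2 <= m ^- 2 * (k.+1%:R ^+ 2)^-1.
Proof.
have mk : 0 < k.+1%:R * m by rewrite mulr_gt0.
rewrite -!exprVn -exprMn -invfM mulrC ler_pXn2r ?nnegrE //.
- by rewrite -[leLHS]invrK lef_pV2 ?posrE ?invr_gt0 ?step_gt0 ?step_inv_ge.
- by rewrite ltW // step_gt0.
- by rewrite invr_ge0 ltW.
Qed.

End StepSizes.

Lemma bigO_inv_square {R : realType} (f : nat -> R) (C : R) :
  (forall k, 0 <= f k.+1 <= C * (k.+1%:R ^+ 2)^-1) ->
  f =O_\oo (fun k : nat => (k%:R ^+ 2)^-1 : R).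
Proof.
move=> fC; apply/eqO_exP; exists (`|C| + 1); first by rewrite ltr_wpDl.
near=> k.
have k0 : (0 < k)%N by near: k; exists 1%N.
have := fC k.-1; rewrite prednK // => /andP[f0 fle].
have kV : 0 <= (k%:R ^+ 2)^-1 :> R by rewrite invr_ge0 sqr_ge0.
rewrite (ger0_norm f0) (ger0_norm kV); apply: (le_trans fle).
by rewrite ler_wpM2r //; have := ler_norm C; lra.
Unshelve. all: by end_near. Qed.

Lemma normD_sqr_le {R : realType} {V : finHilbertType R} (y z : V) :
  `|y + z| ^+ 2 <= 2 * `|y| ^+ 2 + 2 * `|z| ^+ 2.
Proof.
by have := inner_ge0 (y - z); rewrite !inner_norm !innerE (inner_sym z y); lra.
Qed.

(** * One iteration *)
Section Iteration.
Context {R : realType} {X U : finHilbertType R}.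
Variables (K : {linear X -> U}) (Kadj : {linear U -> X}).
Hypothesis adjK : is_adjoint K Kadj.

(** Everything is expressed with [a = x - xs] and the increments [dr], [dg],
[Kadj (u - us)] and [Kadj (u1 - us)] of the optimality system.  The right hand
side minus the left hand side is then [2 gamma] times the sum of the two
monotonicity terms, plus [gamma^2 |dr + Kadj (u - us)|^2]. *)
Lemma primal_dual_step (gamma eta : R)
    (x xR x1 xs r rs g gs : X) (u u1 us : U) :
  0 < gamma ->
  xR = x - gamma *: (r + g + Kadj u) ->
  x1 = xR - gamma *: Kadj (u1 - u) ->
  rs + gs + Kadj us = 0 ->
  0 <= inner (r - rs) (xR - xs) ->
  0 <= inner (K xR + (gamma * eta) *: (u - u1) - K xs) (u1 - us) ->
  `|x1 - xs| ^+ 2 + gamma ^+ 2 * eta * `|u1 - us| ^+ 2 <=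
    `|x - xs| ^+ 2 - 2 * gamma * inner (g - gs) (x - xs)
    + gamma ^+ 2 * `|g - gs| ^+ 2 + gamma ^+ 2 * eta * `|u - us| ^+ 2
    - gamma ^+ 2 * (eta * `|u1 - u| ^+ 2 - `|Kadj (u1 - u)| ^+ 2).
Proof.
move=> gamma0 xRE x1E kktE.
pose a := x - xs; pose dr := r - rs; pose dg := g - gs.
pose v0 := u - us; pose v1 := u1 - us.
have xRs : xR - xs = a - gamma *: (dr + dg + Kadj v0).
  have -> : dr + dg + Kadj v0 = r + g + Kadj u.
    rewrite -[RHS]subr0 -kktE /v0 linearB /dr /dg.
    by rewrite [X in X + (Kadj u - _)]addrACA [LHS]addrACA !opprD.
  by rewrite xRE /a addrAC.
have uu : u1 - u = v1 - v0 by rewrite /v1 /v0 opprB addrA subrK.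
have x1s : x1 - xs = a - gamma *: (dr + dg + Kadj v1).
  rewrite x1E addrAC xRs uu -addrA -opprD -scalerDr; congr (_ - _ *: _).
  by rewrite -addrA -linearD [v0 + _]addrC subrK.
have -> : K xR + (gamma * eta) *: (u - u1) - K xs =
    K (xR - xs) + (gamma * eta) *: (v0 - v1).
  by rewrite /v0 /v1 opprB addrA subrK [K (xR - xs)]linearB addrAC.
rewrite [inner (K _ + _) _]innerDl adjK xRs uu x1s.
rewrite -/a -/dr -/dg -/v0 -/v1 [Kadj (v1 - v0)]linearB.
clear xRs uu x1s; clearbody a dr dg v0 v1.
move: (Kadj v0) (Kadj v1) => p0 p1.
rewrite -(pmulr_rge0 _ gamma0) => h1; rewrite -(pmulr_rge0 _ gamma0); move: h1.
have := mulr_ge0 (sqr_ge0 gamma) (inner_ge0 (dr + p0)).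
rewrite !inner_norm !innerE (inner_sym v1 v0).
rewrite (inner_sym p1 p0) !(inner_sym _ a) !(inner_sym dg dr) !(inner_sym _ dr).
rewrite !(inner_sym _ dg).
lra.
Qed.

(** Cocoercivity uses up the share [1 - kappa] of the inner product to absorb
the squared gradient; the share [kappa] that remains gives the contraction. *)
Lemma forward_step (gamma kappa mu L : R) (a dg : X) :
  0 < gamma -> 0 < kappa -> gamma * L <= 2 * (1 - kappa) ->
  `|dg| ^+ 2 <= L * inner dg a -> mu * `|a| ^+ 2 <= inner dg a -> 0 <= mu ->
  `|a| ^+ 2 - 2 * gamma * inner dg a + gamma ^+ 2 * `|dg| ^+ 2
    <= (1 - 2 * gamma * mu * kappa) * `|a| ^+ 2.
Proof.
move=> g0 k0 gL coco mono mu0.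
have i0 : 0 <= inner dg a by apply: le_trans mono; rewrite mulr_ge0 ?sqr_ge0.
have h1 : gamma ^+ 2 * `|dg| ^+ 2 <= gamma * (gamma * L) * inner dg a.
  have -> : gamma * (gamma * L) * inner dg a = gamma ^+ 2 * (L * inner dg a).
    by ring.
  by rewrite ler_pM2l // exprn_gt0.
have h2 : gamma * (gamma * L) * inner dg a
    <= gamma * (2 * (1 - kappa)) * inner dg a.
  by rewrite ler_wpM2r // ler_pM2l.
have h3 : gamma * kappa * (mu * `|a| ^+ 2) <= gamma * kappa * inner dg a.
  by rewrite ler_pM2l // mulr_gt0.
lra.
Qed.

End Iteration.

(** * Convergence of the algorithm *)
Section PDDYConvergence.
Context {R : realType} {X U : finHilbertType R}.
Variables (K : {linear X -> U}) (Kadj : {linear U -> X}).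
Variables (Rf : X -> \bar R) (H : U -> \bar R) (F : X -> R) (gradF : X -> X).
Variables (L mu kappa eta : R) (gamma : nat -> R).
Variables (xR x p : nat -> X) (u : nat -> U) (xs : X) (us : U).
Hypothesis adjK : is_adjoint K Kadj.
Hypotheses (pR : proper_ereal Rf) (cR : convex_ereal Rf) (pH : proper_ereal H).
Hypotheses (L0 : 0 < L) (mu0 : 0 < mu) (kappa0 : 0 < kappa) (eta0 : 0 < eta).
Hypothesis smoothF : convex_smooth L F gradF.
Hypothesis strongF : strongly_convex mu F.
Hypothesis gamma0 : 0 < gamma 0%N < 2 * (1 - kappa) / L.
Hypothesis gamma0_lt1 : 2 * gamma 0%N * (mu * kappa) < 1.
Hypothesis gamma1 : gamma 1%N = gamma 0%N.
Hypothesis gammaS : forall k, (1 <= k)%N ->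
  gamma k.+1 = - gamma k ^+ 2 * (mu * kappa)
    + gamma k * Num.sqrt ((gamma k * (mu * kappa)) ^+ 2 + 1).
Hypothesis eta_ge : opnorm K ^+ 2 <= eta.
Hypothesis algo : PDDY gradF Rf H K Kadj gamma eta xR x p u.
Hypothesis kkt_xs : kkt gradF Rf H K Kadj xs us.

Let m0 : 0 < mu * kappa. Proof. exact: mulr_gt0. Qed.
Let g0 : 0 < gamma 0%N. Proof. by case/andP: gamma0. Qed.
Let gamma_gt0 k : 0 < gamma k.
Proof. exact: step_gt0 m0 g0 gamma1 gammaS k. Qed.

Lemma adjoint_sqr_le v : `|Kadj v| ^+ 2 <= eta * `|v| ^+ 2.
Proof.
apply: le_trans (_ : opnorm K ^+ 2 * `|v| ^+ 2 <= _); last first.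
  by rewrite ler_wpM2r // sqr_ge0.
rewrite -exprMn ler_pXn2r ?nnegrE //; first exact: adjoint_opnorm_le.
by rewrite mulr_ge0 // opnorm_ge0.
Qed.

(** [primal_dual_step] applied to the subgradients that the proximal steps
provide: [rk] for [Rf] at [xR], and, for the conjugate of [H] at the new dual
point, the vector [K xR + g eta (u - u')]. *)
Lemma pddy_descent k :
  `|x k.+2 - xs| ^+ 2 + gamma k.+1 ^+ 2 * eta * `|u k.+2 - us| ^+ 2 <=
    (1 - 2 * gamma k.+1 * mu * kappa) * `|x k.+1 - xs| ^+ 2
    + gamma k.+1 ^+ 2 * eta * `|u k.+1 - us| ^+ 2.
Proof.
have [cF gradFP gradFL] := smoothF.
have [Hus [r Rr rE]] := kkt_xs.
set g := gamma k.+1; have gg : 0 < g by exact: gamma_gt0.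
pose rk := g^-1 *: (x k.+1 - g *: gradF (x k.+1) - g *: p k.+1 - xR k.+1).
have Rrk : subdiff Rf (xR k.+1) rk by exact: prox_subdiff (pddy_xR algo k).
have pE := pddy_p algo.
have xRE : xR k.+1 = x k.+1 - g *: (rk + gradF (x k.+1) + Kadj (u k.+1)).
  rewrite 2!scalerDr (scalerA g) mulfV ?gt_eqF // scale1r pE.
  move: (g *: gradF _) (g *: Kadj _) => a b; move: (xR _) (x _) => y z.
  rewrite [z - a - b - y]addrAC [z - a - y]addrAC.
  by rewrite [z - y - a - b + a]addrAC !subrK opprB addrC subrK.
have x1E : x k.+2 = xR k.+1 - g *: Kadj (u k.+2 - u k.+1).
  by rewrite (pddy_x algo) !pE [Kadj (_ - _)]linearB.
have Hu : subdiff (conjugate H) (u k.+2)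
    ((g * eta) *: (u k.+1 + (g * eta)^-1 *: K (xR k.+1) - u k.+2)).
  rewrite -[X in X *: _]invrK.
  apply: prox_subdiff (pddy_u algo k.+1).
  - exact: conjugate_proper Hus.
  - exact: conjugate_convex.
  - by rewrite invr_gt0 mulr_gt0.
have Hu' := subdiff_conjugate pH Hus.
have monR := subdiff_monotone pR Rrk Rr.
have := subdiff_monotone (conjugate_proper pH Hus) Hu Hu'.
rewrite addrAC scalerDr scalerA mulfV ?gt_eqF ?mulr_gt0 // scale1r.
rewrite [X in X - K xs]addrC => monH.
have := primal_dual_step adjK gg xRE x1E rE monR monH.
have gL : g * L <= 2 * (1 - kappa).
  rewrite -ler_pdivlMr //.
  apply: le_trans (step_le_first m0 g0 gamma1 gammaS k) _.
  by case/andP: gamma0 => _ /ltW.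
have := forward_step gg kappa0 gL
  (gradient_cocoercive gradFP cF L0 gradFL (x k.+1) xs)
  (strong_monotonicity gradFP cF strongF (x k.+1) xs) (ltW mu0).
have := ler_wpM2l (sqr_ge0 g) (adjoint_sqr_le (u k.+2 - u k.+1)).
by lra.
Qed.

(** The index is shifted by one because the primal sequence starts at [x 1]. *)
Definition energy k := (1 - 2 * gamma k.+1 * mu * kappa) / gamma k.+1 ^+ 2
  * `|x k.+1 - xs| ^+ 2 + eta * `|u k.+1 - us| ^+ 2.

(** Dominates [energy 0], because [gamma 1 = gamma 0] and the dual increment
enters through a nonnegative quadratic form. *)
Definition energy_bound := (1 - 2 * gamma 0%N * mu * kappa) / gamma 0%N ^+ 2
  * (`|x 1%N - xs| ^+ 2 + gamma 0%N ^+ 2 * eta * `|u 1%N - u 0%N| ^+ 2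
     - gamma 0%N ^+ 2 * `|Kadj (u 1%N - u 0%N)| ^+ 2)
  + eta * `|u 1%N - us| ^+ 2.

Let mk2E (a : R) : 2 * a * mu * kappa = 2 * a * (mu * kappa).
Proof. by rewrite !mulrA. Qed.

Let contraction_gt0 k : 0 < 1 - 2 * gamma k.+1 * mu * kappa.
Proof.
rewrite mk2E subr_gt0; exact: step_lt1 m0 g0 gamma0_lt1 gamma1 gammaS k.
Qed.

Lemma energy_ge0 k : 0 <= energy k.
Proof.
by rewrite addr_ge0 ?mulr_ge0 ?sqr_ge0 ?invr_ge0 ?sqr_ge0 // ltW.
Qed.

Lemma energy_nincr k : energy k.+1 <= energy k.
Proof.
have gg : 0 < gamma k.+1 ^+ 2 by rewrite exprn_gt0.
have cE : (1 - 2 * gamma k.+2 * mu * kappa) / gamma k.+2 ^+ 2 = gamma k.+1 ^- 2.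
  rewrite -[LHS]invrK invf_div mk2E.
  by rewrite (step_ratio m0 g0 gamma0_lt1 gamma1 gammaS k).
rewrite /energy cE -(ler_pM2l gg) !mulrDr mulVKf ?gt_eqF //.
rewrite (mulrAC (1 - _)) [X in _ <= X + _]mulrC divfK ?gt_eqF //.
rewrite !(mulrA _ eta); exact: pddy_descent.
Qed.

Lemma energy_le_bound k : energy k <= energy_bound.
Proof.
elim: k => [|k IH]; last exact: le_trans (energy_nincr k) IH.
have a0 : 0 <= (1 - 2 * gamma 0%N * mu * kappa) / gamma 0%N ^+ 2.
  by rewrite -gamma1 divr_ge0 ?sqr_ge0 // ltW.
rewrite /energy /energy_bound gamma1 lerD2r ler_wpM2l //.
rewrite -addrA lerDl -mulrA -mulrBr.
by rewrite mulr_ge0 ?sqr_ge0 // subr_ge0 adjoint_sqr_le.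
Qed.

Lemma energy_bound_ge0 : 0 <= energy_bound.
Proof. exact: le_trans (energy_ge0 0) (energy_le_bound 0). Qed.

(** The primal term of the energy is itself at most the energy. *)
Lemma primal_rate k : `|x k.+2 - xs| ^+ 2 <=
  gamma k.+2 ^+ 2 / (1 - 2 * gamma k.+2 * mu * kappa) * energy_bound.
Proof.
have q0 : 0 < gamma k.+2 ^+ 2 / (1 - 2 * gamma k.+2 * mu * kappa).
  by rewrite divr_gt0 // exprn_gt0.
rewrite mulrC -ler_pdivrMr // invf_div mulrC.
apply: le_trans (energy_le_bound k.+1).
by rewrite lerDl mulr_ge0 ?sqr_ge0 // ltW.
Qed.

Lemma primal_rate_sqr k : `|x k.+2 - xs| ^+ 2 <= gamma k.+1 ^+ 2 * energy_bound.
Proof.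
apply: le_trans (primal_rate k) _.
by rewrite mk2E (step_ratio m0 g0 gamma0_lt1 gamma1 gammaS k).
Qed.

Lemma dual_bounded k : eta * `|u k.+1 - us| ^+ 2 <= energy_bound.
Proof.
apply: le_trans (energy_le_bound k); rewrite lerDr.
by rewrite mulr_ge0 ?sqr_ge0 // divr_ge0 ?sqr_ge0 // ltW.
Qed.

(** [xR] differs from the next [x] by a multiple of [g Kadj (u' - u)], and the
dual iterates are bounded.  The constant 10 is [2 + 2 * 4], from using
[|y + z|^2 <= 2 |y|^2 + 2 |z|^2] twice. *)
Lemma prox_primal_rate k :
  `|xR k.+1 - xs| ^+ 2 <= 10 * energy_bound * gamma k.+1 ^+ 2.
Proof.
have -> : xR k.+1 - xs = (x k.+2 - xs) + gamma k.+1 *: Kadj (u k.+2 - u k.+1).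
  by rewrite (pddy_x algo) !(pddy_p algo) [Kadj (_ - _)]linearB addrAC subrK.
apply: le_trans (normD_sqr_le _ _) _.
rewrite normrZ exprMn real_normK ?num_real //.
have h1 := primal_rate_sqr k.
have h2 : `|Kadj (u k.+2 - u k.+1)| ^+ 2 <= 4 * energy_bound.
  apply: le_trans (adjoint_sqr_le _) _.
  have -> : u k.+2 - u k.+1 = (u k.+2 - us) + (us - u k.+1).
    by rewrite addrA subrK.
  apply: le_trans (ler_wpM2l (ltW eta0) (normD_sqr_le _ _)) _.
  have := dual_bounded k; have := dual_bounded k.+1.
  by rewrite (distrC us); lra.
have := ler_wpM2l (sqr_ge0 (gamma k.+1)) h2.
by lra.
Qed.

End PDDYConvergence.

(** * The accelerated rate *)

Theorem theorem4 (R : realType) (X U : finHilbertType R)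
    (K : {linear X -> U}) (Kadj : {linear U -> X})
    (Rf : X -> \bar R) (H : U -> \bar R) (F : X -> R) (gradF : X -> X)
    (L_F mu_F kappa eta : R) (gamma : nat -> R)
    (xR x p : nat -> X) (u : nat -> U)
    (dimX : (0 < \dim {:X})%N)
    (adjK : is_adjoint K Kadj)
    (pccR : proper_closed_convex Rf) (pccH : proper_closed_convex H)
    (L_F_gt0 : 0 < L_F) (smoothF : convex_smooth L_F F gradF)
    (mu_F_gt0 : 0 < mu_F) (strongF : strongly_convex mu_F F)
    (standing : exists x0 u0, kkt gradF Rf H K Kadj x0 u0)
    (kappa01 : 0 < kappa < 1)
    (gamma0 : 0 < gamma 0%N < 2 * (1 - kappa) / L_F)
    (gamma1 : gamma 1%N = gamma 0%N)
    (gammaS : forall k, (1 <= k)%N ->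
       gamma k.+1 = - gamma k ^+ 2 * mu_F * kappa
         + gamma k * Num.sqrt ((gamma k * mu_F * kappa) ^+ 2 + 1))
    (eta_gt0 : 0 < eta) (eta_ge : opnorm K ^+ 2 <= eta)
    (algo : PDDY gradF Rf H K Kadj gamma eta xR x p u) :
  exists xs : X,
    [/\ unique (minimizer (primal_obj F Rf H K)) xs,
        forall us : U, minimizer (dual_obj F Rf H Kadj) us
          <-> kkt gradF Rf H K Kadj xs us,
        exists c0 : R,
          [/\ 0 < c0,
              forall k, (1 <= k)%N ->
                `|x k.+1 - xs| ^+ 2 <=
                  gamma k.+1 ^+ 2 / (1 - gamma k.+1 * mu_F * kappa) * c0
            & (fun k : nat =>
                 gamma k.+1 ^+ 2 / (1 - gamma k.+1 * mu_F * kappa) * c0)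
                =O_\oo (fun k : nat => (k%:R ^+ 2)^-1 : R)],
        forall us : U, minimizer (dual_obj F Rf H Kadj) us ->
          let c0 :=
            (1 - 2 * gamma 0%N * mu_F * kappa) / gamma 0%N ^+ 2
              * (`|x 1%N - xs| ^+ 2
                 + gamma 0%N ^+ 2 * eta * `|u 1%N - u 0%N| ^+ 2
                 - gamma 0%N ^+ 2 * `|Kadj (u 1%N - u 0%N)| ^+ 2)
            + eta * `|u 1%N - us| ^+ 2 in
          0 <= c0 /\
          (forall k, (1 <= k)%N ->
             `|x k.+1 - xs| ^+ 2 <=
               gamma k.+1 ^+ 2 / (1 - 2 * gamma k.+1 * mu_F * kappa) * c0)
      & opnorm K ^+ 2 < eta ->
          (fun k : nat => `|xR k - xs| ^+ 2)
            =O_\oo (fun k : nat => (k%:R ^+ 2)^-1 : R)].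
Proof.
have [cF gradFP gradFL] := smoothF.
have [pR _ cR] := pccR; have [pH _ _] := pccH.
have [xs [u0 kkt0]] := standing.
have [kappa0 kappa1] := andP kappa01; have [g0 gL] := andP gamma0.
have Fge y := gradient_ineq gradFP cF xs y.
have dual v := kkt_dual_minimizer adjK pR pH cR v Fge
  (descent_lemma gradFP gradFL xs) kkt0.
have g0m : 2 * gamma 0%N * (mu_F * kappa) < 1.
  have muL := strong_convexity_le_smoothness gradFP cF gradFL strongF dimX.
  have gL1 : gamma 0%N * L_F < 2 * (1 - kappa) by rewrite -ltr_pdivlMr.
  have h1 : 2 * gamma 0%N * (mu_F * kappa) <= 2 * (gamma 0%N * L_F) * kappa.
    have -> : 2 * gamma 0%N * (mu_F * kappa) = 2 * (gamma 0%N * mu_F) * kappa.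
      by ring.
    by rewrite ler_pM2r // ler_pM2l // ler_pM2l.
  have h2 : 2 * (gamma 0%N * L_F) * kappa < 2 * (2 * (1 - kappa)) * kappa.
    by rewrite ltr_pM2r // ltr_pM2l.
  (* [4 kappa (1 - kappa) <= 1] is the nonnegativity of this square. *)
  have := sqr_ge0 (2 * kappa - 1).
  by lra.
have gS k : (1 <= k)%N -> gamma k.+1 = - gamma k ^+ 2 * (mu_F * kappa)
    + gamma k * Num.sqrt ((gamma k * (mu_F * kappa)) ^+ 2 + 1).
  by move=> /gammaS ->; rewrite !mulrA.
have m0 : 0 < mu_F * kappa by rewrite mulr_gt0.
have rate us (kus : kkt gradF Rf H K Kadj xs us) := primal_rate adjK pR cR pH
  L_F_gt0 mu_F_gt0 kappa0 eta_gt0 smoothF strongF gamma0 g0m gamma1 gS eta_ge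
  algo kus.
have bound_ge0 us (kus : kkt gradF Rf H K Kadj xs us) :=
  energy_bound_ge0 adjK pR cR pH L_F_gt0 mu_F_gt0 kappa0 eta_gt0 smoothF
    strongF gamma0 g0m gamma1 gS eta_ge algo kus.
have rateR := prox_primal_rate adjK pR cR pH
  L_F_gt0 mu_F_gt0 kappa0 eta_gt0 smoothF strongF gamma0 g0m gamma1 gS eta_ge
  algo kkt0.
pose bound us := energy_bound Kadj mu_F kappa eta gamma x u xs us.
pose rho := 1 - 2 * gamma 0%N * (mu_F * kappa).
have rho0 : 0 < rho by rewrite subr_gt0.
have bound0 := bound_ge0 _ kkt0; rewrite -/(bound u0) in bound0.
(* The summand 1 makes the constant positive even if the iterates start at the
   solution. *)
pose c := bound u0 / rho + 1.
have c_gt0 : 0 < c by rewrite ltr_wpDl // divr_ge0 // ltW.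
have gg0 := step_gt0 m0 g0 gamma1 gS.
have sqr_le := step_sqr_le m0 g0 g0m gamma1 gS.
have ratio_ge0 k : 0 <= gamma k.+1 ^+ 2 / (1 - gamma k.+1 * mu_F * kappa).
  rewrite divr_ge0 ?sqr_ge0 // subr_ge0 -mulrA.
  have := step_lt1 m0 g0 g0m gamma1 gS k.
  by have := mulr_gt0 (gg0 k.+1) m0; lra.
exists xs; split.
- apply: (kkt_unique_minimizer adjK pR pH mu_F_gt0 _ kkt0).
  exact: strong_convexity_ineq.
- exact: dual.
- exists c; split=> //.
  + case=> // k _; apply: le_trans (rate _ kkt0 k) _.
    have := ler_wpM2r bound0 (step_ratio_le_half m0 g0 g0m gamma1 gS k.+1).
    rewrite -/rho !(mulrA _ mu_F) => /le_trans; apply.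
    rewrite -[leLHS]mulrA (mulrC rho^-1).
    by apply: ler_wpM2l; rewrite ?ratio_ge0 // lerDl.
  + apply: (@bigO_inv_square _ _ (c * (mu_F * kappa) ^- 2)) => k.
    rewrite mulr_ge0 ?ratio_ge0 ?(ltW c_gt0) //=.
    rewrite [leLHS]mulrC -[leRHS]mulrA ler_pM2l //.
    apply: le_trans (sqr_le k).
    rewrite -(step_ratio m0 g0 g0m gamma1 gS k) -(mulrA _ mu_F).
    exact: step_ratio_half_le m0 g0 g0m gamma1 gS k.+1.
- move=> us /dual kus; split; first exact: bound_ge0.
  by case=> // k _; exact: rate.
- move=> _.
  apply: (@bigO_inv_square _ _ (10 * bound u0 * (mu_F * kappa) ^- 2)) => k.
  rewrite sqr_ge0; apply: le_trans (rateR k) _.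
  by rewrite -!mulrA !ler_wpM2l // -/(bound u0) mulrA -exprVn sqr_le.
Qed.
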